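(* Let $n\ge0$, $\delta t>0$, and let $(c_i)_{j,k}^n$ ($1\le i\le N$, $1\le j,k\le M$) be given. Consider the finite difference scheme for the unknowns $(c_i)^{n+1}_{j,k}$, $\phi^{n+1}_{j,k}$: for $1\le j,k\le M$ and $1\le i\le N$, $$\begin{aligned}\frac{(c_i)_{j,k}^{n+1}-(c_i)_{j,k}^n}{\delta t}=\frac{D_i}{\delta x^2}\Big[&\frac{(c_i)_{j+1,k}^n+(c_i)_{j,k}^n}{2}\big((\mu_i)_{j+1,k}^{n+1}-(\mu_i)_{j,k}^{n+1}\big)-\frac{(c_i)_{j,k}^n+(c_i)_{j-1,k}^n}{2}\big((\mu_i)_{j,k}^{n+1}-(\mu_i)_{j-1,k}^{n+1}\big)\\&+\frac{(c_i)_{j,k+1}^n+(c_i)_{j,k}^n}{2}\big((\mu_i)_{j,k+1}^{n+1}-(\mu_i)_{j,k}^{n+1}\big)-\frac{(c_i)_{j,k}^n+(c_i)_{j,k-1}^n}{2}\big((\mu_i)_{j,k}^{n+1}-(\mu_i)_{j,k-1}^{n+1}\big)\Big],\end{aligned}$$ $$-\epsilon\,\frac{\phi_{j+1,k}^{n+1}+\phi_{j-1,k}^{n+1}+\phi_{j,k+1}^{n+1}+\phi_{j,k-1}^{n+1}-4\phi_{j,k}^{n+1}}{\delta x^2}=\rho_0+\sum_{i=1}^Nz_i(c_i)_{j,k}^{n+1},$$ where $(\mu_i)_{j,k}^{n+1}=\log(c_i)_{j,k}^{n+1}+z_i\big(\phi_{j,k}^{n+1}+(\phi_e)_{j,k}\big)$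 for $1\le j,k\le M$, with the discrete Neumann boundary conditions and the normalization $\sum_{j,k=1}^M\phi_{j,k}^{n+1}=0$ described in the context. Then: 1. (Mass conservation) Any solution satisfies $\displaystyle\delta x^2\sum_{j,k=1}^M(c_i)_{j,k}^{n+1}=\delta x^2\sum_{j,k=1}^M(c_i)_{j,k}^n$ for $1\le i\le N$. Moreover, if $(c_i)_{j,k}^n>0$ for all $i$ and all $(j,k)$, then: 2. (Unique solvability) The scheme possesses a unique solution $(\{(c_i)_{j,k}^{n+1}\},\phi_{j,k}^{n+1})$. 3. (Positivity) $(c_i)_{j,k}^{n+1}>0$ for all $i$ and all $(j,k)$. 4. (Energy dissipation) $$\begin{aligned}\tilde E^{n+1}-\tilde E^n\le-\delta t\sum_{i=1}^N\frac{D_i}{\delta x^2}\Big[&\sum_{\substack{1\le j\le M-1\\1\le k\le M}}\frac{(c_i)_{j+1,k}^n+(c_i)_{j,k}^n}{2}\big((\mu_i)_{j+1,k}^{n+1}-(\mu_i)_{j,k}^{n+1}\big)^2\\&+\sum_{\substack{1\le j\le M\\1\le k\le M-1}}\frac{(c_i)_{j,k+1}^n+(c_i)_{j,k}^n}{2}\big((\mu_i)_{j,k+1}^{n+1}-(\mu_i)_{j,k}^{n+1}\big)^2\Big],\end{aligned}$$ where, for $m\in\{n,n+1\}$, $$\tilde E^m=\sum_{i=1}^N\sum_{j,k=1}^M(c_i)_{j,k}^m\big(\log(c_i)_{j,k}^m-1\big)+\sum_{j,k=1}^M\Big[\rho_0+\sum_{i=1}^Nz_i(c_i)_{j,k}^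m\Big]\cdot\Big[\frac12\phi_{j,k}^m+(\phi_e)_{j,k}\Big].$$
   Context: The domain $[0,L]^2$ ($L>0$) is discretized at the $M^2$ points $x_{j,k}=\big((j-\frac12)\delta x,(k-\frac12)\delta x\big)$, $j,k=1,\dots,M$, $\delta x=L/M$. $N\ge1$; $z_i\in\mathbb{R}$, $D_i>0$, $\epsilon>0$, $\rho_0\in\mathbb{R}$ are constants; $(\phi_e)_{j,k}$ are the given real values of an external potential at the grid points. The scheme discretizes the Poisson--Nernst--Planck equations with homogeneous Neumann boundary conditions on the chemical potentials and on $\phi$. Discrete Neumann boundary conditions (ghost values): for $u=(\mu_i)^{n+1}$ ($1\le i\le N$) and $u=\phi^{n+1}$, $$u_{0,k}=u_{1,k},\quad u_{M+1,k}=u_{M,k}\ (1\le k\le M),\qquad u_{j,0}=u_{j,1},\quad u_{j,M+1}=u_{j,M}\ (1\le j\le M).$$ The ghost values of $c_i^n$ are always multiplied by a vanishing difference of $\mu_i^{n+1}$ and are irrelevant. A solution is required to be such that $\log(c_i)^{n+1}_{j,k}$ is defined for all $1\le j,k\le M$. Standing assumptions: discrete electroneutrality $\sum_{j,k=1}^M\big(\rho_0+\sum_iz_i(c_i)_{j,k}^n\big)=0$; and $\phi^n_{j,k}$ is the potential associated with $(c_i)^n_{j,k}$, i.e. it satisfies the same discrete Poisson equation, boundary conditions and normalization with $n+1$ replaced by $n$. *)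

(* Defs.v *)
From mathcomp Require Import all_boot all_order all_algebra.
From mathcomp Require Import all_classical all_reals all_analysis.

Set Implicit Arguments.
Unset Strict Implicit.
Unset Printing Implicit Defensive.

Import Order.TTheory GRing.Theory Num.Theory.
Local Open Scope ring_scope.

(* u j k is the value at the point ((j - 1/2) dx, (k - 1/2) dx).  Only the
   indices 1 <= j, k <= M are grid points; indices 0 and M+1 are ghost points. *)
Definition gridfun (R : realType) := nat -> nat -> R.

Definition on_grid (M j k : nat) : bool := (1 <= j <= M)%N && (1 <= k <= M)%N.

Definition grid_sum (R : realType) (M : nat) (u : gridfun R) : R :=
  \sum_(1 <= j < M.+1) \sum_(1 <= k < M.+1) u j k.

Definition discrete_neumann (R : realType) (M : nat) (u : gridfun R) : Prop :=
  (forall k, (1 <= k <= M)%N -> u 0%N k = u 1%N k /\ u M.+1 k = u M k) /\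
  (forall j, (1 <= j <= M)%N -> u j 0%N = u j 1%N /\ u j M.+1 = u j M).

(* [ln] is total, with junk value 0 on x <= 0: it is the inverse of [expR] on
   the range of [expR], which is where log x is defined. *)
Definition log_defined (R : realType) (x : R) : Prop := exists y : R, expR y = x.

Section Scheme.
Variables (R : realType) (N M : nat).
Variables (L eps rho0 : R) (D z : 'I_N -> R) (phie : gridfun R).

Definition dx : R := L / M%:R.

Definition charge (c : 'I_N -> gridfun R) : gridfun R :=
  fun j k => rho0 + \sum_(i < N) z i * c i j k.

Definition electroneutral (c : 'I_N -> gridfun R) : Prop :=
  grid_sum M (charge c) = 0.

Definition potential_of (c : 'I_N -> gridfun R) (phi : gridfun R) : Prop :=
  [/\ forall j k, on_grid M j k ->
        - eps * ((phi j.+1 k + phi j.-1 k + phi j k.+1 + phi j k.-1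
                  - 4 * phi j k) / dx ^+ 2) = charge c j k,
      discrete_neumann M phi
    & grid_sum M phi = 0].

(* One time step, cn being c^n and (c, phi, mu) the quantities at n+1.  The
   ghost values of cn and c are unconstrained. *)
Record scheme_solution (dt : R) (cn c : 'I_N -> gridfun R) (phi : gridfun R)
    (mu : 'I_N -> gridfun R) : Prop := SchemeSolution {
  scheme_log : forall i j k, on_grid M j k -> log_defined (c i j k);
  scheme_mu : forall i j k, on_grid M j k ->
    mu i j k = ln (c i j k) + z i * (phi j k + phie j k);
  scheme_mu_neumann : forall i, discrete_neumann M (mu i);
  scheme_np : forall i j k, on_grid M j k ->
    (c i j k - cn i j k) / dt =
    D i / dx ^+ 2 *
      ((cn i j.+1 k + cn i j k) / 2 * (mu i j.+1 k - mu i j k)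
       - (cn i j k + cn i j.-1 k) / 2 * (mu i j k - mu i j.-1 k)
       + (cn i j k.+1 + cn i j k) / 2 * (mu i j k.+1 - mu i j k)
       - (cn i j k + cn i j k.-1) / 2 * (mu i j k - mu i j k.-1));
  scheme_poisson : potential_of c phi
}.

Definition energy (c : 'I_N -> gridfun R) (phi : gridfun R) : R :=
  \sum_(i < N) grid_sum M (fun j k => c i j k * (ln (c i j k) - 1))
  + grid_sum M (fun j k => charge c j k * (phi j k / 2 + phie j k)).

Definition dissipation (cn mu : 'I_N -> gridfun R) : R :=
  \sum_(i < N) D i / dx ^+ 2 *
    (\sum_(1 <= j < M) \sum_(1 <= k < M.+1)
        (cn i j.+1 k + cn i j k) / 2 * (mu i j.+1 k - mu i j k) ^+ 2
     + \sum_(1 <= j < M.+1) \sum_(1 <= k < M)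
        (cn i j k.+1 + cn i j k) / 2 * (mu i j k.+1 - mu i j k) ^+ 2).

End Scheme.

(* Main.v *)
Require Import Defs.
From mathcomp Require Import all_boot all_order all_algebra.
From mathcomp Require Import all_classical all_reals all_analysis.
From mathcomp Require Import ring lra.

(** Summation by parts turns the discrete divergence into the symmetric edge
    forms E_i (weighted by the averages of c_i^n) and E (unit weights).
    Testing the scheme with 1 gives mass conservation.  Testing it with mu, and
    using the convexity of x (log x - 1), gives energy dissipation; applied to
    the difference of two solutions, with the monotonicity of log instead, it
    gives uniqueness.

    For existence, eliminate c_i = exp(mu_i - z_i (phi + phi_e)) and minimize,
    without constraint, the convex function of (mu, phi)
      sum_i sum exp(mu_i - z_i (phi + phi_e)) - sum_i <c_i^n, mu_i>
      - rho_0 <1, phi> + dt / (2 dx^2) sum_i D_i E_i(mu_i, mu_i)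
      + eps / (2 dx^2) E(phi, phi) + <1, phi>^2 / 2,
    whose critical points are the solutions; positivity of c is automatic.
    Coercivity: the quadratic part q controls all differences of values of
    mu_i and phi itself, with errors in o(q) + O(1), and then the exponentials
    against <c_i^n, mu_i> control the remaining N constants, since
    sum c_i^n > 0. *)

Import Order.TTheory GRing.Theory Num.Theory.
Import numFieldNormedType.Exports.

Set Implicit Arguments.
Unset Strict Implicit.
Unset Printing Implicit Defensive.

Local Open Scope ring_scope.

(** * Sums over grid points *)

Section GridSums.
Variables (R : realType) (M : nat).
Implicit Types u v : gridfun R.

Lemma eq_grid_sum u v :
  (forall j k, on_grid M j k -> u j k = v j k) -> grid_sum M u = grid_sum M v.
Proof.
move=> uv; apply: eq_big_nat => j hj; apply: eq_big_nat => k hk.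
by apply: uv; apply/andP; split.
Qed.

Lemma grid_sumD u v :
  grid_sum M (fun j k => u j k + v j k) = grid_sum M u + grid_sum M v.
Proof.
by rewrite /grid_sum -big_split; apply: eq_bigr => j _; rewrite -big_split.
Qed.

Lemma grid_sumZ (x : R) u :
  grid_sum M (fun j k => x * u j k) = x * grid_sum M u.
Proof. by rewrite /grid_sum mulr_sumr; apply: eq_bigr => j _; rewrite mulr_sumr. Qed.

Lemma grid_sumB u v :
  grid_sum M (fun j k => u j k - v j k) = grid_sum M u - grid_sum M v.
Proof.
rewrite -[- grid_sum M v]mulN1r -grid_sumZ -grid_sumD.
by apply: eq_grid_sum => j k _; rewrite mulN1r.
Qed.

Lemma grid_sum_sum (I : finType) (F : I -> gridfun R) :
  grid_sum M (fun j k => \sum_i F i j k) = \sum_i grid_sum M (F i).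
Proof.
rewrite /grid_sum [RHS]exchange_big; apply: eq_bigr => j _.
by rewrite exchange_big.
Qed.

Lemma le_grid_sum u v :
  (forall j k, on_grid M j k -> u j k <= v j k) -> grid_sum M u <= grid_sum M v.
Proof.
move=> uv; apply: ler_sum_nat => j hj; apply: ler_sum_nat => k hk.
by apply: uv; apply/andP; split.
Qed.

Lemma grid_sum0 : grid_sum M (fun _ _ => 0 : R) = 0.
Proof. by rewrite /grid_sum big1// => j _; rewrite big1. Qed.

Lemma grid_sum_cst (x : R) : grid_sum M (fun _ _ => x) = M%:R ^+ 2 * x.
Proof.
by rewrite /grid_sum !sumr_const_nat subSS subn0 -mulrnA -[LHS]mulr_natl natrM expr2.
Qed.

Lemma grid_sum_ge0 u :
  (forall j k, on_grid M j k -> 0 <= u j k) -> 0 <= grid_sum M u.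
Proof. by move=> u0; rewrite -grid_sum0; exact: le_grid_sum. Qed.

Lemma ge_nat_sum_term (m n i : nat) (F : nat -> R) : (m <= i < n)%N ->
  (forall j, (m <= j < n)%N -> 0 <= F j) -> F i <= \sum_(m <= j < n) F j.
Proof.
move=> hi F0; rewrite (bigD1_seq i) ?mem_index_iota ?iota_uniq//= lerDl.
rewrite big_seq_cond sumr_ge0// => j; rewrite mem_index_iota => /andP[? _].
exact: F0.
Qed.

Lemma ge_grid_sum_term u j k : on_grid M j k ->
  (forall j k, on_grid M j k -> 0 <= u j k) -> u j k <= grid_sum M u.
Proof.
move=> /andP[hj hk] u0; rewrite /grid_sum.
have u0' j' k' : (1 <= j' < M.+1)%N -> (1 <= k' < M.+1)%N -> 0 <= u j' k'.
  by move=> h1 h2; apply: u0; apply/andP; split.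
apply: (le_trans (@ge_nat_sum_term 1 M.+1 k (u j) hk _)) => [k' hk'|].
  exact: u0'.
apply: (@ge_nat_sum_term 1 M.+1 j (fun j => \sum_(1 <= k < M.+1) u j k)) => // j' hj'.
by rewrite big_nat sumr_ge0// => k' hk'; exact: u0'.
Qed.

Lemma grid_sum_eq0 u : (forall j k, on_grid M j k -> 0 <= u j k) ->
  grid_sum M u <= 0 -> forall j k, on_grid M j k -> u j k = 0.
Proof.
move=> u0 s0 j k h; apply/eqP; rewrite eq_le u0// andbT.
exact: le_trans (ge_grid_sum_term h u0) s0.
Qed.

Lemma grid_sum_delta (u : gridfun R) p r : on_grid M p r ->
  grid_sum M (fun j k => ((j == p) && (k == r))%:R * u j k) = u p r.
Proof.
move=> /andP[hp hr]; rewrite /grid_sum (bigD1_seq p) ?mem_index_iota ?iota_uniq//=.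
rewrite (bigD1_seq r) ?mem_index_iota ?iota_uniq//= !eqxx mul1r.
rewrite big1 ?addr0 => [|k /negbTE ->]; last by rewrite mul0r.
by rewrite big1 ?addr0// => j /negbTE ->; rewrite big1// => k _; rewrite mul0r.
Qed.

End GridSums.

(** * Summation by parts and symmetric edge forms *)

Section EdgeForm.
Variables (R : realType) (M : nat).
Implicit Types a b u v : gridfun R.

(* [a j k] weighs the edge from (j, k) to (j+1, k), and [b j k] the edge from
   (j, k) to (j, k+1). *)
Definition edge_form a b u v : R :=
  \sum_(1 <= j < M) \sum_(1 <= k < M.+1)
     a j k * ((u j.+1 k - u j k) * (v j.+1 k - v j k))
  + \sum_(1 <= j < M.+1) \sum_(1 <= k < M)
     b j k * ((u j k.+1 - u j k) * (v j k.+1 - v j k)).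

(** The five-point Laplacian with edge weights, written as a difference of fluxes. *)
Definition wlap a b u : gridfun R := fun j k =>
  a j k * (u j.+1 k - u j k) - a j.-1 k * (u j k - u j.-1 k)
  + b j k * (u j k.+1 - u j k) - b j k.-1 * (u j k - u j k.-1).

Lemma summation_by_parts (m : nat) (F v : nat -> R) : (1 <= m)%N ->
  F 0%N = 0 -> F m = 0 ->
  \sum_(1 <= j < m.+1) v j * (F j - F j.-1)
  = - \sum_(1 <= j < m) F j * (v j.+1 - v j).
Proof.
case: m => // m _ F0 Fm.
(* Keeping the upper boundary term lets the induction on the length go through; it vanishes with the
   last flux. *)
suff: \sum_(1 <= j < m.+2) v j * (F j - F j.-1)
    = v m.+1 * F m.+1 - \sum_(1 <= j < m.+1) F j * (v j.+1 - v j).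
  by move=> ->; rewrite Fm mulr0 sub0r.
elim: m {Fm} => [|m ih]; first by rewrite big_nat1 big_geq//= F0 !subr0.
by rewrite big_nat_recr//= ih [in RHS]big_nat_recr//=; ring.
Qed.

(** The Neumann condition on [u] kills the fluxes [P] and [Q] at indices 0 and M, so there are no
    boundary terms, and [v] may be arbitrary. Summation by parts is applied line by line in each
    direction. *)
Lemma grid_sum_wlap a b u v : (1 <= M)%N -> discrete_neumann M u ->
  grid_sum M (fun j k => v j k * wlap a b u j k) = - edge_form a b u v.
Proof.
move=> hM [hx hy].
pose P j k := a j k * (u j.+1 k - u j k).
pose Q j k := b j k * (u j k.+1 - u j k).
have -> : grid_sum M (fun j k => v j k * wlap a b u j k) =
    grid_sum M (fun j k => v j k * (P j k - P j.-1 k))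
    + grid_sum M (fun j k => v j k * (Q j k - Q j k.-1)).
  rewrite -grid_sumD; apply: eq_grid_sum => j k /andP[/andP[j1 _] /andP[k1 _]].
  by rewrite /P /Q /wlap !prednK//; ring.
rewrite /edge_form opprD; congr (_ + _).
- rewrite /grid_sum exchange_big_nat/= [in RHS]exchange_big_nat/= -sumrN.
  apply: eq_big_nat => k hk; have [u0 uM] := hx k hk.
  rewrite (@summation_by_parts M (P ^~ k) (v ^~ k)) // /P ?u0 ?uM ?subrr ?mulr0//.
  by congr (- _); apply: eq_bigr => j _; rewrite -mulrA.
- rewrite /grid_sum -sumrN.
  apply: eq_big_nat => j hj; have [u0 uM] := hy j hj.
  rewrite (@summation_by_parts M (Q j) (v j)) // /Q ?u0 ?uM ?subrr ?mulr0//.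
  by congr (- _); apply: eq_bigr => k _; rewrite -mulrA.
Qed.

Lemma edge_formC a b u v : edge_form a b u v = edge_form a b v u.
Proof.
by congr (_ + _); apply: eq_bigr => j _; apply: eq_bigr => k _; congr (_ * _);
  rewrite mulrC.
Qed.

Lemma edge_formDl a b u v w : edge_form a b (fun j k => u j k + v j k) w
  = edge_form a b u w + edge_form a b v w.
Proof.
rewrite /edge_form addrACA -!big_split; congr (_ + _);
  by apply: eq_bigr => j _; rewrite -big_split; apply: eq_bigr => k _ /=; ring.
Qed.

Lemma edge_formZl a b (x : R) u v :
  edge_form a b (fun j k => x * u j k) v = x * edge_form a b u v.
Proof.
rewrite /edge_form mulrDr !mulr_sumr; congr (_ + _);
  by apply: eq_bigr => j _; rewrite mulr_sumr; apply: eq_bigr => k _ /=; ring.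
Qed.

Lemma edge_formZr a b (x : R) u v :
  edge_form a b u (fun j k => x * v j k) = x * edge_form a b u v.
Proof. by rewrite edge_formC edge_formZl edge_formC. Qed.

Lemma edge_formD a b u v : edge_form a b (fun j k => u j k + v j k)
    (fun j k => u j k + v j k)
  = edge_form a b u u + 2 * edge_form a b u v + edge_form a b v v.
Proof.
rewrite edge_formDl ![edge_form a b _ (fun j k => _ + _)]edge_formC !edge_formDl.
by rewrite [edge_form a b v u]edge_formC; ring.
Qed.

Lemma edge_form_cst a b u (x : R) : edge_form a b u (fun _ _ => x) = 0.
Proof.
by rewrite /edge_form !big1 ?addr0// => j _; rewrite big1// => k _; rewrite subrr !mulr0.
Qed.

Lemma eq_edge_form a b u u' v v' :
  (forall j k, on_grid M j k -> u j k = u' j k) ->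
  (forall j k, on_grid M j k -> v j k = v' j k) ->
  edge_form a b u v = edge_form a b u' v'.
Proof.
move=> uu vv.
have grid j k : (1 <= j < M.+1)%N -> (1 <= k < M.+1)%N -> on_grid M j k.
  by move=> hj hk; apply/andP; split.
have lt1 j : (1 <= j < M)%N -> (1 <= j < M.+1)%N /\ (1 <= j.+1 < M.+1)%N.
  by case/andP=> j1 jM; rewrite j1; split=> //; exact: ltnW.
congr (_ + _); apply: eq_big_nat => j hj; apply: eq_big_nat => k hk.
- by have [h1 h2] := lt1 j hj; rewrite !(uu, vv)//; exact: grid.
- by have [h1 h2] := lt1 k hk; rewrite !(uu, vv)//; exact: grid.
Qed.

(** The guards exclude the edges that lead to ghost points, which [edge_form] does not contain. *)
Definition nonneg_weights a b : Prop := forall j k, on_grid M j k ->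
  ((j < M)%N -> 0 <= a j k) /\ ((k < M)%N -> 0 <= b j k).

Lemma edge_form_terms a b u : nonneg_weights a b ->
  [/\ 0 <= edge_form a b u u,
   (forall j k, on_grid M j k -> (j < M)%N ->
     a j k * (u j.+1 k - u j k) ^+ 2 <= edge_form a b u u)
  & (forall j k, on_grid M j k -> (k < M)%N ->
     b j k * (u j k.+1 - u j k) ^+ 2 <= edge_form a b u u)].
Proof.
move=> ab0.
have hA j k : (1 <= j < M)%N -> (1 <= k < M.+1)%N ->
    0 <= a j k * ((u j.+1 k - u j k) * (u j.+1 k - u j k)).
  move=> /andP[j1 jM] hk; apply: mulr_ge0; last by rewrite -expr2 sqr_ge0.
  by apply (ab0 j k) => //; rewrite /on_grid j1 (ltnW jM) hk.
have hB j k : (1 <= j < M.+1)%N -> (1 <= k < M)%N ->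
    0 <= b j k * ((u j k.+1 - u j k) * (u j k.+1 - u j k)).
  move=> hj /andP[k1 kM]; apply: mulr_ge0; last by rewrite -expr2 sqr_ge0.
  by apply (ab0 j k) => //; rewrite /on_grid k1 (ltnW kM) hj.
have sA j : (1 <= j < M)%N -> 0 <= \sum_(1 <= k < M.+1)
     a j k * ((u j.+1 k - u j k) * (u j.+1 k - u j k)).
  by move=> hj; rewrite big_nat sumr_ge0// => k; exact: hA.
have sB j : (1 <= j < M.+1)%N -> 0 <= \sum_(1 <= k < M)
     b j k * ((u j k.+1 - u j k) * (u j k.+1 - u j k)).
  by move=> hj; rewrite big_nat sumr_ge0// => k; exact: hB.
have ssA : 0 <= \sum_(1 <= j < M) \sum_(1 <= k < M.+1)
     a j k * ((u j.+1 k - u j k) * (u j.+1 k - u j k)).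
  by rewrite big_nat sumr_ge0.
have ssB : 0 <= \sum_(1 <= j < M.+1) \sum_(1 <= k < M)
     b j k * ((u j k.+1 - u j k) * (u j k.+1 - u j k)).
  by rewrite big_nat sumr_ge0.
split=> [|j k /andP[/andP[j1 _] hk] jM|j k /andP[hj /andP[k1 _]] kM].
- exact: addr_ge0.
- have hj : (1 <= j < M)%N by rewrite j1.
  rewrite expr2 /edge_form -[X in X <= _]addr0; apply: lerD => //.
  apply: (le_trans (@ge_nat_sum_term R 1 M.+1 k
    (fun k => a j k * ((u j.+1 k - u j k) * (u j.+1 k - u j k))) hk _)).
    by move=> k' hk'; exact: hA.
  by apply: (@ge_nat_sum_term R 1 M j (fun j => \sum_(1 <= k < M.+1)
     a j k * ((u j.+1 k - u j k) * (u j.+1 k - u j k)))).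
- have hk : (1 <= k < M)%N by rewrite k1.
  rewrite expr2 /edge_form -[X in X <= _]add0r; apply: lerD => //.
  apply: (le_trans (@ge_nat_sum_term R 1 M k
    (fun k => b j k * ((u j k.+1 - u j k) * (u j k.+1 - u j k))) hk _)).
    by move=> k' hk'; exact: hB.
  by apply: (@ge_nat_sum_term R 1 M.+1 j (fun j => \sum_(1 <= k < M)
     b j k * ((u j k.+1 - u j k) * (u j k.+1 - u j k)))).
Qed.

End EdgeForm.

(** Connectivity of the grid as an induction principle: from (1,1) one moves along the line j = 1,
    then in the direction of increasing j. *)
Lemma grid_path_ind (M : nat) (P : nat -> nat -> Prop) : P 1%N 1%N ->
  (forall j k, on_grid M j k -> (j < M)%N -> P j k -> P j.+1 k) ->
  (forall j k, on_grid M j k -> (k < M)%N -> P j k -> P j k.+1) ->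
  forall j k, on_grid M j k -> P j k.
Proof.
move=> P11 Px Py.
have P1 k : (1 <= k <= M)%N -> P 1%N k.
  elim: k => [//|[//|k] ih] /andP[_ kM]; apply: Py => //; last exact/ih/ltnW.
  by rewrite /on_grid (ltnW kM) (leq_trans _ kM).
elim=> [//|[_ k /andP[_ hk]|j ih k /andP[/andP[_ jM] hk]]]; first exact: P1.
have jk : on_grid M j.+1 k by rewrite /on_grid (ltnW jM) hk.
by apply: Px => //; exact: ih.
Qed.

(** Each edge term lies between 0 and the whole form, so every edge difference vanishes, and
    connectivity propagates the value at (1,1). *)
Lemma edge_form_eq0 (R : realType) (M : nat) (a b u : gridfun R) :
  (forall j k, on_grid M j k -> ((j < M)%N -> 0 < a j k) /\ ((k < M)%N -> 0 < b j k)) ->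
  edge_form M a b u u <= 0 -> forall j k, on_grid M j k -> u j k = u 1%N 1%N.
Proof.
move=> ab0 E0.
have [_ hx hy] : [/\ 0 <= edge_form M a b u u,
   (forall j k, on_grid M j k -> (j < M)%N ->
     a j k * (u j.+1 k - u j k) ^+ 2 <= edge_form M a b u u)
  & (forall j k, on_grid M j k -> (k < M)%N ->
     b j k * (u j k.+1 - u j k) ^+ 2 <= edge_form M a b u u)].
  by apply: edge_form_terms => j k /ab0[h1 h2]; split=> ?; apply: ltW; auto.
have sq0 (w d : R) : 0 < w -> w * d ^+ 2 <= 0 -> d = 0.
  move=> w0; rewrite pmulr_rle0// => d0; apply/eqP; rewrite -sqrf_eq0.
  by rewrite eq_le d0 sqr_ge0.
apply: grid_path_ind => // j k h lt <-; apply/eqP; rewrite -subr_eq0; apply/eqP.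
- by apply: (sq0 (a j k)); [apply (ab0 j k) | apply: le_trans E0; exact: hx].
- by apply: (sq0 (b j k)); [apply (ab0 j k) | apply: le_trans E0; exact: hy].
Qed.

(** * Convexity of the entropy density and monotonicity of the logarithm *)

Section Logarithm.
Variable R : realType.
Implicit Types x y : R.

Lemma log_defined_gt0 x : log_defined x -> 0 < x.
Proof. by case=> y <-; exact: expR_gt0. Qed.

(** The tangent inequality at [x], where the derivative of x (log x - 1) is log x. It is
    [1 + t <= expR t] at [t = ln x - ln y], multiplied by [y]. *)
Lemma xlnx_convex x y : 0 < x -> 0 < y ->
  x * (ln x - 1) - y * (ln y - 1) <= ln x * (x - y).
Proof.
move=> x0 y0; have := expR_ge1Dx (ln x - ln y).
rewrite expRB !lnK ?posrE// -(ler_pM2l y0) => h.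
have yxy : y * (x / y) = x by field; rewrite gt_eqF.
by rewrite yxy in h; nra.
Qed.

Lemma ln_increment_ge0 x y : 0 < x -> 0 < y -> 0 <= (x - y) * (ln x - ln y).
Proof.
move=> x0 y0; have [xy|/ltW xy] := leP x y; last first.
  by apply: mulr_ge0; rewrite subr_ge0// ler_ln.
by apply: mulr_le0; rewrite subr_le0// ler_ln.
Qed.

Lemma ln_increment_eq0 x y : 0 < x -> 0 < y ->
  (x - y) * (ln x - ln y) = 0 -> x = y.
Proof.
move=> x0 y0 /eqP; rewrite mulf_eq0 !subr_eq0 => /orP[/eqP//|/eqP].
by apply: ln_inj.
Qed.

End Logarithm.

(** * Weak form of the scheme; mass conservation, uniqueness and energy dissipation *)

Section Scheme.
Variables (R : realType) (N M : nat).
Variables (L eps rho0 : R) (D z : 'I_N -> R) (phie : gridfun R).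
Hypotheses (hM : (1 <= M)%N) (hL : 0 < L) (heps : 0 < eps) (hD : forall i, 0 < D i).
Variable dt : R.
Hypothesis hdt : 0 < dt.
Variable cn : 'I_N -> gridfun R.

Local Notation solution := (scheme_solution M L eps rho0 D z phie dt cn).
Local Notation dx := (dx M L).
Local Notation charge := (Defs.charge rho0 z).

Definition avgx (u : gridfun R) : gridfun R := fun j k => (u j.+1 k + u j k) / 2.
Definition avgy (u : gridfun R) : gridfun R := fun j k => (u j k.+1 + u j k) / 2.
Definition unit_weight : gridfun R := fun _ _ => 1.

Definition mobility_form i := edge_form M (avgx (cn i)) (avgy (cn i)).
Definition dirichlet_form := edge_form M unit_weight unit_weight.

Lemma dx_gt0 : 0 < dx.
Proof. by rewrite divr_gt0// ltr0n. Qed.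

Lemma avg_weights i : (forall j k, on_grid M j k -> 0 < cn i j k) ->
  forall j k, on_grid M j k ->
    ((j < M)%N -> 0 < avgx (cn i) j k) /\ ((k < M)%N -> 0 < avgy (cn i) j k).
Proof.
move=> c0 j k h; have h0 := c0 _ _ h; move: h => /andP[/andP[j1 jM] /andP[k1 kM]].
by split=> lt; rewrite divr_gt0// addr_gt0// c0// /on_grid ?j1 ?k1 ?jM ?kM ?lt.
Qed.

Lemma mobility_form_ge0 i u : (forall j k, on_grid M j k -> 0 < cn i j k) ->
  0 <= mobility_form i u u.
Proof.
move=> c0; have w : nonneg_weights M (avgx (cn i)) (avgy (cn i)).
  by move=> j k /(avg_weights c0)[h1 h2]; split=> ?; apply: ltW; auto.
by case: (edge_form_terms u w).
Qed.

Lemma dirichlet_form_ge0 u : 0 <= dirichlet_form u u.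
Proof.
have w : nonneg_weights M unit_weight unit_weight by split=> _; exact: ler01.
by case: (edge_form_terms u w).
Qed.

(** [wlap] takes its backward weights at [j.-1] and [k.-1]; these are the averages of the scheme
    because [j.-1.+1 = j] and [k.-1.+1 = k] for indices at least 1. *)
Lemma scheme_npE i (u : gridfun R) j k : on_grid M j k ->
  (cn i j.+1 k + cn i j k) / 2 * (u j.+1 k - u j k)
  - (cn i j k + cn i j.-1 k) / 2 * (u j k - u j.-1 k)
  + (cn i j k.+1 + cn i j k) / 2 * (u j k.+1 - u j k)
  - (cn i j k + cn i j k.-1) / 2 * (u j k - u j k.-1)
  = wlap (avgx (cn i)) (avgy (cn i)) u j k.
Proof.
by move=> /andP[/andP[j1 _] /andP[k1 _]]; rewrite /wlap /avgx /avgy !prednK.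
Qed.

(** Weak form of the transport equation. The test function needs no boundary condition, as the
    Neumann condition on [mu i] already removes the boundary fluxes. *)
Lemma weak_np c phi mu : solution c phi mu -> forall i (v : gridfun R),
  grid_sum M (fun j k => v j k * (c i j k - cn i j k))
  = - (dt * (D i / dx ^+ 2)) * mobility_form i (mu i) v.
Proof.
move=> s i v; rewrite mulNr -mulrN -grid_sum_wlap//; last exact: scheme_mu_neumann s i.
rewrite -grid_sumZ; apply: eq_grid_sum => j k h; have := scheme_np s i h.
rewrite scheme_npE// => e; have -> : c i j k - cn i j k = dt * ((c i j k - cn i j k) / dt).
  by field; rewrite gt_eqF.
by rewrite e; ring.
Qed.

Lemma weak_poisson c phi : potential_of M L eps rho0 z c phi -> forall v : gridfun R,
  grid_sum M (fun j k => v j k * charge c j k) = eps / dx ^+ 2 * dirichlet_form phi v.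
Proof.
case=> hp nphi _ v; rewrite -[dirichlet_form _ _]opprK -grid_sum_wlap// mulrN -mulNr.
rewrite -grid_sumZ; apply: eq_grid_sum => j k h; rewrite -hp// /wlap /unit_weight.
by field; rewrite gt_eqF// dx_gt0.
Qed.

Lemma scheme_gt0 c phi mu : solution c phi mu ->
  forall i j k, on_grid M j k -> 0 < c i j k.
Proof. by move=> s i j k h; apply: log_defined_gt0; exact: scheme_log s i j k h. Qed.

Lemma scheme_mass c phi mu : solution c phi mu ->
  forall i, grid_sum M (c i) = grid_sum M (cn i).
Proof.
move=> s i; apply/eqP; rewrite -subr_eq0 -grid_sumB; apply/eqP.
have := weak_np s i (fun _ _ => 1); rewrite /mobility_form edge_form_cst mulr0 => <-.
by apply: eq_grid_sum => j k _; rewrite mul1r.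
Qed.

Hypothesis cn_gt0 : forall i j k, on_grid M j k -> 0 < cn i j k.

(** Testing the differences of the equations with [w] and [psi] yields two nonnegative quantities
    whose sum is minus a dissipation. Strict monotonicity of the logarithm then identifies the
    concentrations, and the normalization identifies the potentials. *)
Lemma scheme_unique c1 phi1 mu1 c2 phi2 mu2 :
  solution c1 phi1 mu1 -> solution c2 phi2 mu2 ->
  forall j k, on_grid M j k ->
    (forall i, c1 i j k = c2 i j k) /\ phi1 j k = phi2 j k.
Proof.
move=> s1 s2.
pose w i j k := mu1 i j k + (-1) * mu2 i j k.
pose psi j k := phi1 j k + (-1) * phi2 j k.
pose F i j k := (c1 i j k - c2 i j k) * (ln (c1 i j k) - ln (c2 i j k)).
have F0 i j k : on_grid M j k -> 0 <= F i j k.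
  by move=> h; apply: ln_increment_ge0; [exact: (scheme_gt0 s1)|exact: (scheme_gt0 s2)].
have np i : grid_sum M (fun j k => w i j k * (c1 i j k - c2 i j k))
    = - (dt * (D i / dx ^+ 2)) * mobility_form i (w i) (w i).
  transitivity (grid_sum M (fun j k => w i j k * (c1 i j k - cn i j k))
      - grid_sum M (fun j k => w i j k * (c2 i j k - cn i j k))).
    by rewrite -grid_sumB; apply: eq_grid_sum => j k _; ring.
  rewrite (weak_np s1) (weak_np s2) /w /mobility_form edge_formDl edge_formZl; ring.
have poisson : grid_sum M (fun j k => psi j k * (charge c1 j k - charge c2 j k))
    = eps / dx ^+ 2 * dirichlet_form psi psi.
  transitivity (grid_sum M (fun j k => psi j k * charge c1 j k)
      - grid_sum M (fun j k => psi j k * charge c2 j k)).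
    by rewrite -grid_sumB; apply: eq_grid_sum => j k _; ring.
  rewrite (weak_poisson (scheme_poisson s1)) (weak_poisson (scheme_poisson s2)).
  by rewrite /psi /dirichlet_form edge_formDl edge_formZl; ring.
(* On the grid [w i] is the difference of the logarithms plus [z i * psi], since [phie] cancels;
   summed over the species, the second part produces the difference of the charges. *)
have tot : grid_sum M (fun j k => \sum_i F i j k)
    + grid_sum M (fun j k => psi j k * (charge c1 j k - charge c2 j k))
    = \sum_i grid_sum M (fun j k => w i j k * (c1 i j k - c2 i j k)).
  rewrite -grid_sum_sum -grid_sumD; apply: eq_grid_sum => j k h.
  rewrite /Defs.charge opprD addrACA subrr add0r -sumrB mulr_sumr -big_split.
  apply: eq_bigr => i _ /=; rewrite /w (scheme_mu s1)// (scheme_mu s2)// /F /psi; ring.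
have edx0 : 0 < eps / dx ^+ 2 by rewrite divr_gt0// exprn_gt0// dx_gt0.
have np0 : \sum_i grid_sum M (fun j k => w i j k * (c1 i j k - c2 i j k)) <= 0.
  apply: sumr_le0 => i _; rewrite np mulNr oppr_le0 mulr_ge0//.
    by rewrite ltW// mulr_gt0// divr_gt0// exprn_gt0// dx_gt0.
  exact/mobility_form_ge0/cn_gt0.
have sF0 j k : on_grid M j k -> 0 <= \sum_i F i j k.
  by move=> h; apply: sumr_ge0 => i _; exact: F0.
have gF0 := grid_sum_ge0 sF0.
have E0 : 0 <= dirichlet_form psi psi := dirichlet_form_ge0 psi.
rewrite poisson in tot.
have eE0 : 0 <= eps / dx ^+ 2 * dirichlet_form psi psi by rewrite mulr_ge0// ltW.
(* In [tot] two nonnegative terms add up to a nonpositive one, so both vanish. *)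
have F_eq0 := grid_sum_eq0 sF0 (ltac:(lra) : grid_sum M (fun j k => \sum_i F i j k) <= 0).
have E_eq0 : dirichlet_form psi psi <= 0 by rewrite -(pmulr_rle0 _ edx0); lra.
have psi_cst := @edge_form_eq0 R M unit_weight unit_weight psi
   (fun j k _ => conj (fun _ => ltr01) (fun _ => ltr01)) E_eq0.
(* A constant with vanishing grid sum is zero. *)
have psi0 j k : on_grid M j k -> psi j k = 0.
  move=> h.
  have : grid_sum M (fun _ _ => psi 1%N 1%N) = 0.
    transitivity (grid_sum M psi); first by apply: eq_grid_sum => ? ? ?; rewrite psi_cst.
    rewrite grid_sumD grid_sumZ; have [_ _ ->] := scheme_poisson s1.
    by have [_ _ ->] := scheme_poisson s2; rewrite mulr0 addr0.
  rewrite grid_sum_cst => /eqP; rewrite mulf_eq0 expf_eq0/= pnatr_eq0 eqn0Ngt hM/=.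
  by move=> /eqP <-; rewrite psi_cst.
move=> j k h; split=> [i|]; last first.
  by apply/eqP; rewrite -subr_eq0 -[phi2 j k]mul1r -mulNr; apply/eqP; exact: psi0.
apply: ln_increment_eq0; [exact: (scheme_gt0 s1)|exact: (scheme_gt0 s2)|].
have /eqP := F_eq0 _ _ h; rewrite psumr_eq0 => [/allP/(_ i)|i' _]; last exact: F0.
by rewrite mem_index_enum => /(_ isT)/eqP.
Qed.

Lemma dissipationE (mu : 'I_N -> gridfun R) :
  dissipation M L D cn mu
  = \sum_i D i / dx ^+ 2 * mobility_form i (mu i) (mu i).
Proof. by []. Qed.

(** Entropy and field energy are both convex in the concentrations, so the increment of the energy
    is at most its derivative at the new time level, which is [mu], paired with the increment of
    [c]. The weak scheme evaluates that pairing. *)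
Lemma scheme_energy c phi mu phin : potential_of M L eps rho0 z cn phin ->
  solution c phi mu ->
  energy M rho0 z phie c phi - energy M rho0 z phie cn phin
  <= - dt * dissipation M L D cn mu.
Proof.
move=> pn s; have p := scheme_poisson s.
have wp := weak_poisson p; have wpn := weak_poisson pn.
have edx0 : 0 < eps / dx ^+ 2 by rewrite divr_gt0// exprn_gt0// dx_gt0.
(* By the weak Poisson equation at both time levels, the two sides differ by [eps / (2 dx^2)] times
   the Dirichlet form of [phi - phin]. *)
have potential : grid_sum M (fun j k => charge c j k * (phi j k / 2 + phie j k))
   - grid_sum M (fun j k => charge cn j k * (phin j k / 2 + phie j k))
   <= grid_sum M (fun j k => (phi j k + phie j k) * (charge c j k - charge cn j k)).
  pose e u := grid_sum M (fun j k => phie j k * charge u j k).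
  have -> : grid_sum M (fun j k => charge c j k * (phi j k / 2 + phie j k))
      = 2^-1 * (eps / dx ^+ 2 * dirichlet_form phi phi) + e c.
    by rewrite -wp -grid_sumZ -grid_sumD; apply: eq_grid_sum => j k _; ring.
  have -> : grid_sum M (fun j k => charge cn j k * (phin j k / 2 + phie j k))
      = 2^-1 * (eps / dx ^+ 2 * dirichlet_form phin phin) + e cn.
    by rewrite -wpn -grid_sumZ -grid_sumD; apply: eq_grid_sum => j k _; ring.
  have -> : grid_sum M (fun j k => (phi j k + phie j k) * (charge c j k - charge cn j k))
      = (eps / dx ^+ 2 * dirichlet_form phi phi + e c)
        - (eps / dx ^+ 2 * dirichlet_form phin phi + e cn).
    rewrite -wp -wpn -!grid_sumD -grid_sumB; apply: eq_grid_sum => j k _; ring.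
  have := dirichlet_form_ge0 (fun j k => phi j k + (-1) * phin j k).
  rewrite /dirichlet_form edge_formD edge_formZl !edge_formZr.
  rewrite [edge_form M _ _ phi phin]edge_formC -/dirichlet_form.
  rewrite -(pmulr_rge0 _ edx0); lra.
have entropy i : grid_sum M (fun j k => c i j k * (ln (c i j k) - 1))
   - grid_sum M (fun j k => cn i j k * (ln (cn i j k) - 1))
   <= grid_sum M (fun j k => ln (c i j k) * (c i j k - cn i j k)).
  rewrite -grid_sumB; apply: le_grid_sum => j k h.
  by apply: xlnx_convex; [exact: (scheme_gt0 s)|exact: cn_gt0].
have weak : grid_sum M (fun j k => (phi j k + phie j k) * (charge c j k - charge cn j k))
   + \sum_i grid_sum M (fun j k => ln (c i j k) * (c i j k - cn i j k))
   = - dt * dissipation M L D cn mu.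
  rewrite dissipationE mulr_sumr -grid_sum_sum -grid_sumD.
  transitivity (\sum_i grid_sum M (fun j k => mu i j k * (c i j k - cn i j k))).
    rewrite -grid_sum_sum; apply: eq_grid_sum => j k h.
    rewrite /Defs.charge opprD addrACA subrr add0r -sumrB mulr_sumr -big_split.
    by apply: eq_bigr => i _ /=; rewrite (scheme_mu s)//; ring.
  by apply: eq_bigr => i _; rewrite (weak_np s) /=; ring.
rewrite -weak /energy.
have : \sum_i grid_sum M (fun j k => c i j k * (ln (c i j k) - 1))
   - \sum_i grid_sum M (fun j k => cn i j k * (ln (cn i j k) - 1))
   <= \sum_i grid_sum M (fun j k => ln (c i j k) * (c i j k - cn i j k)).
  by rewrite -sumrB; apply: ler_sum => i _; exact: entropy.
lra.
Qed.

End Scheme.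

(** * Minima on boxes, stationarity and elementary bounds for the exponential *)

Section Minimization.
Variable R : realType.

(** Tychonoff makes the box compact in the product topology even for an infinite index type. *)
Lemma box_min (I : eqType) (F : prod_topology (fun _ : I => R) -> R) (B : R) :
  0 <= B -> continuous F ->
  exists2 x, (forall i, `|x i| <= B) &
    forall y : I -> R, (forall i, `|y i| <= B) -> F x <= F y.
Proof.
move=> B0 cF.
pose A := [set f : prod_topology (fun _ : I => R) | forall i, `[- B, B]%classic (f i)]%classic.
have cA : compact A := @tychonoff I (fun=> R) (fun=> `[- B, B]%classic) (fun=> @segment_compact _ _ _).
have boxE x : A x <-> forall i, `|x i| <= B.
  by split=> h i; move: (h i); rewrite /= in_itv/= ler_norml.
have A0 : (A !=set0)%classic by exists (fun=> 0); apply/boxE => i; rewrite normr0.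
have [x /set_mem /boxE xA xmin] := compact_EVT_min A0 cA (continuous_subspaceT cF).
by exists x => // y hy; apply: xmin; apply/mem_set/boxE.
Qed.

Lemma stationary_of_quadratic_bound (l C : R) :
  (forall t, `|t| <= 1 -> 0 <= t * l + C * t ^+ 2) -> l = 0.
Proof.
move=> h; apply/eqP; apply: contraT => l0.
(* At [t = - l / K] the bound reads [(C - K) * (l / K) ^+ 2]. The summand [|l|] makes this [t]
   admissible, and [K > C] makes the value negative. *)
pose K := 1 + `|C| + `|l|.
have K0 : 0 < K by rewrite /K -addrA ltr_pwDl// addr_ge0.
have lK : `|- l / K| <= 1.
  by rewrite normrM normrN normfV (gtr0_norm K0) ler_pdivrMr// mul1r /K lerDr addr_ge0.
have := h _ lK; have -> : - l / K * l + C * (- l / K) ^+ 2 = (C - K) * (l / K) ^+ 2.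
  by field; rewrite gt_eqF.
have l2 : 0 < (l / K) ^+ 2.
  by rewrite lt_neqAle sqr_ge0 andbT eq_sym sqrf_eq0 mulf_neq0// invr_eq0 gt_eqF.
rewrite pmulr_lge0// subr_ge0 => KC; have := ler_norm C.
have l0' : 0 < `|l| by rewrite normr_gt0.
by rewrite /K in KC; lra.
Qed.

(** A substitute for Taylor's formula. Applying [1 + x <= expR x] at [y] and at [- y] gives
    [expR y - 1 - y <= y * (expR y - 1)], which is at most [y ^+ 2 * expR |s|] for either sign of
    [y]. *)
Lemma expR_quadratic_bound (s t : R) : `|t| <= 1 ->
  expR (t * s) <= 1 + t * s + t ^+ 2 * (s ^+ 2 * expR `|s|).
Proof.
move=> t1; set y := t * s.
have ey : expR y <= expR `|s|.
  rewrite ler_expR (le_trans (ler_norm _))// normrM -[leRHS]mul1r ler_wpM2r//.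
have e1 : 1 <= expR `|s| by rewrite -expR0 ler_expR.
have up : expR y - 1 <= y * expR y.
  have := expR_ge1Dx (- y); rewrite expRN -(ler_pM2l (expR_gt0 y)) divff ?gt_eqF ?expR_gt0//; lra.
have lo := expR_ge1Dx y; have := expR_gt0 y.
rewrite mulrA -exprMn -/y => ey0.
have [y0|/ltW y0] := leP 0 y; nra.
Qed.

(** The tangent of slope [K], touching at [ln K]. *)
Lemma expR_tangent (K y : R) : 0 < K -> K * (1 + y - ln K) <= expR y.
Proof.
move=> K0; have := expR_ge1Dx (y - ln K).
rewrite expRB lnK ?posrE// ler_pdivlMr// mulrC; lra.
Qed.

End Minimization.

(** * Calculus of quantities that are o(q) + O(1) *)

Section Subordinate.
Variables (R : realType) (T : Type) (q : T -> R).
Hypothesis q_ge0 : forall x, 0 <= q x.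

(* Y is o(q) + O(1), uniformly on T. *)
Definition subordinate (Y : T -> R) : Prop :=
  forall e, 0 < e -> exists C, forall x, `|Y x| <= e * q x + C.

Lemma eq_subordinate Y Y' : Y =1 Y' -> subordinate Y -> subordinate Y'.
Proof. by move=> /funext ->. Qed.

Lemma subordinate_cst (a : R) : subordinate (fun=> a).
Proof. by move=> e e0; exists `|a| => x; rewrite lerDr mulr_ge0// ltW. Qed.

Lemma subordinate_norm Y : subordinate Y -> subordinate (fun x => `|Y x|).
Proof. by move=> nY e /nY[C h]; exists C => x; rewrite normr_id. Qed.

Lemma subordinateD Y Z : subordinate Y -> subordinate Z ->
  subordinate (fun x => Y x + Z x).
Proof.
move=> nY nZ e e0; have e2 : 0 < e / 2 by rewrite divr_gt0.
have [[C hC] [C' hC']] := (nY _ e2, nZ _ e2); exists (C + C') => x.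
by have := (ler_normD (Y x) (Z x), hC x, hC' x) => -[[? ?] ?]; lra.
Qed.

Lemma subordinateZ (a : R) Y : subordinate Y -> subordinate (fun x => a * Y x).
Proof.
move=> nY e e0; have a0 : 0 < `|a| + 1 by rewrite ltr_wpDl.
have [C hC] := nY _ (divr_gt0 e0 a0); exists ((`|a| + 1) * C) => x.
rewrite normrM; apply: (@le_trans _ _ ((`|a| + 1) * `|Y x|)).
  by rewrite ler_wpM2r// lerDl.
apply: (le_trans (ler_wpM2l (ltW a0) (hC x))).
by rewrite mulrDr lerD2r mulrA [_ * (e / _)]mulrC divfK// gt_eqF.
Qed.

Lemma subordinateB Y Z : subordinate Y -> subordinate Z ->
  subordinate (fun x => Y x - Z x).
Proof.
move=> nY /(subordinateZ (-1)) /(subordinateD nY); apply: eq_subordinate => x.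
by rewrite mulN1r.
Qed.

(** Young's inequality: [|Y| <= e c Y^2 + 1 / (e c)]. *)
Lemma subordinate_sqr c Y : 0 < c -> (forall x, c * Y x ^+ 2 <= q x) ->
  subordinate Y.
Proof.
move=> c0 h e e0; have ec0 : 0 < e * c by exact: mulr_gt0.
exists (e * c)^-1 => x; have := h x; rewrite -(ler_pM2l e0) mulrA => {}h.
apply: le_trans (lerD h (lexx _)).
rewrite -(ler_pM2l ec0) mulrDr divff ?gt_eqF// -[Y x ^+ 2]real_normK ?num_real//.
rewrite [leRHS](_ : _ = (e * c * `|Y x|) ^+ 2 + 1); last by ring.
have := sqr_ge0 (e * c * `|Y x| - 2^-1).
have := sqr_ge0 (e * c * `|Y x|); set w := e * c * _; nra.
Qed.

Lemma subordinate_sum (J : eqType) (s : seq J) (F : T -> J -> R) :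
  (forall i, i \in s -> subordinate (F ^~ i)) ->
  subordinate (fun x => \sum_(i <- s) F x i).
Proof.
elim: s => [_|i s ih h].
  by apply: eq_subordinate (subordinate_cst 0) => x; rewrite big_nil.
apply: (@eq_subordinate (fun x => F x i + \sum_(j <- s) F x j)) => [x|].
  by rewrite big_cons.
apply: subordinateD; first by apply: h; rewrite mem_head.
by apply: ih => j js; apply: h; rewrite inE js orbT.
Qed.

Lemma subordinate_grid_sum M (F : T -> gridfun R) :
  (forall j k, on_grid M j k -> subordinate (fun x => F x j k)) ->
  subordinate (fun x => grid_sum M (F x)).
Proof.
move=> h; apply: (subordinate_sum (F := fun x j => \sum_(1 <= k < M.+1) F x j k)) => j.
rewrite mem_index_iota => hj; apply: (subordinate_sum (F := fun x k => F x j k)) => k.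
by rewrite mem_index_iota => hk; apply: h; apply/andP; split.
Qed.

(** The square of each edge difference is bounded by a multiple of [q]; the increments from (1,1)
    telescope along grid paths. *)
Lemma subordinate_increment M (a b : gridfun R) c (U : T -> gridfun R) :
  0 < c ->
  (forall j k, on_grid M j k -> ((j < M)%N -> 0 < a j k) /\ ((k < M)%N -> 0 < b j k)) ->
  (forall x, c * edge_form M a b (U x) (U x) <= q x) ->
  forall j k, on_grid M j k -> subordinate (fun x => U x j k - U x 1%N 1%N).
Proof.
move=> c0 ab0 Uq.
have w : nonneg_weights M a b by move=> j k /ab0[h1 h2]; split=> ?; apply: ltW; auto.
apply: grid_path_ind => [|j k h lt ih|j k h lt ih].
- by apply: eq_subordinate (subordinate_cst 0) => x; rewrite subrr.
- apply: (@eq_subordinate (fun x => (U x j.+1 k - U x j k) + (U x j k - U x 1%N 1%N))) => [x|].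
    by ring.
  apply: subordinateD => //; apply: (@subordinate_sqr (c * a j k)) => [|x].
    by rewrite mulr_gt0//; apply (ab0 j k).
  apply: le_trans (Uq x); rewrite -mulrA ler_pM2l//.
  by case: (edge_form_terms (U x) w) => _ + _; exact.
- apply: (@eq_subordinate (fun x => (U x j k.+1 - U x j k) + (U x j k - U x 1%N 1%N))) => [x|].
    by ring.
  apply: subordinateD => //; apply: (@subordinate_sqr (c * b j k)) => [|x].
    by rewrite mulr_gt0//; apply (ab0 j k).
  apply: le_trans (Uq x); rewrite -mulrA ler_pM2l//.
  by case: (edge_form_terms (U x) w) => _ _; exact.
Qed.

End Subordinate.

(** * Continuity of grid sums and edge forms *)

Section ContinuousGridFunctions.
Variables (R : realType) (X : topologicalType).
Implicit Types F G : X -> R.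

Lemma continuous_add F G : continuous F -> continuous G ->
  continuous (fun x => F x + G x).
Proof. by move=> cF cG x; exact: continuousD (cF x) (cG x). Qed.

Lemma continuous_mul F G : continuous F -> continuous G ->
  continuous (fun x => F x * G x).
Proof. by move=> cF cG x; exact: continuousM (cF x) (cG x). Qed.

Lemma continuous_cst (a : R) : continuous (fun _ : X => a).
Proof. by move=> x; exact: cst_continuous. Qed.

Lemma continuous_sub F G : continuous F -> continuous G ->
  continuous (fun x => F x - G x).
Proof. by move=> cF cG x; exact: continuousB (cF x) (cG x). Qed.

Lemma continuous_bigsum (J : Type) (s : seq J) (F : X -> J -> R) :
  (forall i, continuous (F ^~ i)) -> continuous (fun x => \sum_(i <- s) F x i).
Proof.
move=> cF; elim: s => [|i s ih].
  by under eq_fun do rewrite big_nil; exact: continuous_cst.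
by under eq_fun do rewrite big_cons; exact: continuous_add.
Qed.

Lemma continuous_grid_sum M (U : X -> gridfun R) :
  (forall j k, continuous (fun x => U x j k)) -> continuous (fun x => grid_sum M (U x)).
Proof.
move=> cU; apply: (continuous_bigsum (F := fun x j => \sum_(1 <= k < M.+1) U x j k)) => j.
exact: (continuous_bigsum (F := fun x k => U x j k)).
Qed.

Lemma continuous_edge_form M (a b : gridfun R) (U : X -> gridfun R) :
  (forall j k, continuous (fun x => U x j k)) ->
  continuous (fun x => edge_form M a b (U x) (U x)).
Proof.
move=> cU; have cd j k j' k' : continuous (fun x => U x j k - U x j' k').
  exact: continuous_sub.
apply: continuous_add.
- apply: (continuous_bigsum (F := fun x j => \sum_(1 <= k < M.+1)
    a j k * ((U x j.+1 k - U x j k) * (U x j.+1 k - U x j k)))) => j.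
  apply: (continuous_bigsum (F := fun x k =>
    a j k * ((U x j.+1 k - U x j k) * (U x j.+1 k - U x j k)))) => k.
  by apply: continuous_mul; [exact: continuous_cst | exact: continuous_mul].
- apply: (continuous_bigsum (F := fun x j => \sum_(1 <= k < M)
    b j k * ((U x j k.+1 - U x j k) * (U x j k.+1 - U x j k)))) => j.
  apply: (continuous_bigsum (F := fun x k =>
    b j k * ((U x j k.+1 - U x j k) * (U x j k.+1 - U x j k)))) => k.
  by apply: continuous_mul; [exact: continuous_cst | exact: continuous_mul].
Qed.

End ContinuousGridFunctions.

(** * Existence by minimization over chemical and electric potentials *)

Section Existence.
Variables (R : realType) (N M : nat).
Variables (L eps rho0 : R) (D z : 'I_N -> R) (phie : gridfun R).
Hypotheses (hM : (1 <= M)%N) (hL : 0 < L) (heps : 0 < eps) (hD : forall i, 0 < D i).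
Variable dt : R.
Hypothesis hdt : 0 < dt.
Variable cn : 'I_N -> gridfun R.
Hypothesis cn_gt0 : forall i j k, on_grid M j k -> 0 < cn i j k.

Local Notation dx := (dx M L).
Local Notation mob := (@mobility_form R N M cn).
Local Notation dir := (@dirichlet_form R M).
Local Notation S := (grid_sum M).

Let kappa i := dt * (D i / dx ^+ 2).
Let beta := eps / dx ^+ 2.

Let kappa_gt0 i : 0 < kappa i.
Proof. by rewrite mulr_gt0// divr_gt0// exprn_gt0// dx_gt0. Qed.

Let beta_gt0 : 0 < beta.
Proof. by rewrite divr_gt0// exprn_gt0// dx_gt0. Qed.

Definition boltzmann (mu : 'I_N -> gridfun R) (phi : gridfun R) : 'I_N -> gridfun R :=
  fun i j k => expR (mu i j k - z i * (phi j k + phie j k)).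

(** The Dirichlet form does not see constants added to [phi]; the squared sum controls that
    direction and takes the place of the normalization constraint. *)
Definition quadratic_part mu phi : R :=
  \sum_i kappa i / 2 * mob i (mu i) (mu i) + beta / 2 * dir phi phi + S phi ^+ 2 / 2.

Definition objective mu phi : R :=
  \sum_i S (boltzmann mu phi i) - \sum_i S (fun j k => cn i j k * mu i j k)
  - rho0 * S phi + quadratic_part mu phi.

Definition objective_derivative mu phi (nu : 'I_N -> gridfun R) (psi : gridfun R) : R :=
  \sum_i S (fun j k => boltzmann mu phi i j k * (nu i j k - z i * psi j k))
  - \sum_i S (fun j k => cn i j k * nu i j k) - rho0 * S psi
  + (\sum_i kappa i * mob i (mu i) (nu i) + beta * dir phi psi + S phi * S psi).

(** A one-sided expansion of second order is enough for stationarity at a minimum. The linear and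
    quadratic parts expand exactly; the exponentials use [expR_quadratic_bound]. *)
Lemma objective_quadratic_bound mu phi nu psi : exists C, forall t, `|t| <= 1 ->
  objective (fun i j k => mu i j k + t * nu i j k) (fun j k => phi j k + t * psi j k)
  <= objective mu phi + (t * objective_derivative mu phi nu psi + C * t ^+ 2).
Proof.
pose a i j k := nu i j k - z i * psi j k.
(* The coefficient of [t ^+ 2]: the remainders of the exponentials plus the quadratic part in the
   direction of the variation. *)
exists (\sum_i S (fun j k => boltzmann mu phi i j k * (a i j k ^+ 2 * expR `|a i j k|))
        + quadratic_part nu psi) => t t1.
pose bo i := S (boltzmann mu phi i).
pose b1 i := S (fun j k => boltzmann mu phi i j k * a i j k).
pose b2 i := S (fun j k => boltzmann mu phi i j k * (a i j k ^+ 2 * expR `|a i j k|)).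
have exps : \sum_i S (boltzmann (fun i j k => mu i j k + t * nu i j k)
      (fun j k => phi j k + t * psi j k) i)
    <= \sum_i bo i + t * \sum_i b1 i + t ^+ 2 * \sum_i b2 i.
  rewrite !mulr_sumr -!big_split; apply: ler_sum => i _ /=.
  rewrite /bo /b1 /b2 -!grid_sumZ -!grid_sumD; apply: le_grid_sum => j k _.
  have -> : boltzmann (fun i j k => mu i j k + t * nu i j k)
      (fun j k => phi j k + t * psi j k) i j k
      = boltzmann mu phi i j k * expR (t * a i j k).
    by rewrite /boltzmann -expRD; congr expR; rewrite /a; ring.
  apply: (le_trans (ler_wpM2l (expR_ge0 _) (expR_quadratic_bound (a i j k) t1))).
  by rewrite /boltzmann; set e := expR (_ - _); rewrite le_eqVlt; apply/orP; left; apply/eqP; ring.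
have lin : \sum_i S (fun j k => cn i j k * (mu i j k + t * nu i j k))
   = \sum_i S (fun j k => cn i j k * mu i j k) + t * \sum_i S (fun j k => cn i j k * nu i j k).
  rewrite mulr_sumr -big_split; apply: eq_bigr => i _ /=.
  by rewrite -grid_sumZ -grid_sumD; apply: eq_grid_sum => j k _; ring.
have form (x y : gridfun R) A B : edge_form M A B (fun j k => x j k + t * y j k)
      (fun j k => x j k + t * y j k)
    = edge_form M A B x x + t * (2 * edge_form M A B x y) + t ^+ 2 * edge_form M A B y y.
  rewrite edge_formD edge_formZl !edge_formZr; ring.
have mobs : \sum_i kappa i / 2 * mob i (fun j k => mu i j k + t * nu i j k)
     (fun j k => mu i j k + t * nu i j k)
   = \sum_i kappa i / 2 * mob i (mu i) (mu i) + t * \sum_i kappa i * mob i (mu i) (nu i)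
     + t ^+ 2 * \sum_i kappa i / 2 * mob i (nu i) (nu i).
  rewrite !mulr_sumr -!big_split; apply: eq_bigr => i _ /=.
  by rewrite /mobility_form form; field.
rewrite /objective /objective_derivative /quadratic_part lin mobs.
rewrite /dirichlet_form form grid_sumD grid_sumZ -/(dir phi phi).
rewrite -/b1 -/b2 -/bo in exps *.
apply: le_trans (lerD (lerD (lerD exps (lexx _)) (lexx _)) (lexx _)) _; rewrite le_eqVlt; apply/orP; left; apply/eqP.
by rewrite /bo /b1 /b2 /a; field.
Qed.

Lemma objective_stationary mu phi :
  (forall nu psi, objective mu phi <= objective nu psi) ->
  forall nu psi, objective_derivative mu phi nu psi = 0.
Proof.
move=> mn nu psi; have [C hC] := objective_quadratic_bound mu phi nu psi.
apply: (@stationary_of_quadratic_bound R _ C) => t t1.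
by have := le_trans (mn _ _) (hC t t1); rewrite lerDl.
Qed.

Lemma continuous_objective (X : topologicalType)
    (mu : X -> 'I_N -> gridfun R) (phi : X -> gridfun R) :
  (forall i j k, continuous (fun x => mu x i j k)) ->
  (forall j k, continuous (fun x => phi x j k)) ->
  continuous (fun x => objective (mu x) (phi x)).
Proof.
move=> cmu cphi; have cS := continuous_grid_sum (M := M) cphi.
apply: continuous_add; first apply: continuous_sub; first apply: continuous_sub.
- apply: (continuous_bigsum (F := fun x i => S (boltzmann (mu x) (phi x) i))) => i.
  apply: continuous_grid_sum => j k x; rewrite /boltzmann.
  apply: (@continuous_comp _ _ _ (fun x => mu x i j k - z i * (phi x j k + phie j k)));
    last exact: continuous_expR.
  apply: continuous_sub => // {}x; apply: continuous_mul; first exact: continuous_cst.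
  by apply: continuous_add => //; exact: continuous_cst.
- apply: (continuous_bigsum (F := fun x i => S (fun j k => cn i j k * mu x i j k))) => i.
  apply: continuous_grid_sum => j k; apply: continuous_mul => //; exact: continuous_cst.
- by apply: continuous_mul => //; exact: continuous_cst.
- apply: continuous_add; first apply: continuous_add.
  + apply: (continuous_bigsum (F := fun x i => kappa i / 2 * mob i (mu x i) (mu x i))) => i.
    by apply: continuous_mul; [exact: continuous_cst | exact: continuous_edge_form].
  + by apply: continuous_mul; [exact: continuous_cst | exact: continuous_edge_form].
  + by apply: continuous_mul; [exact: continuous_mul | exact: continuous_cst].
Qed.


(** Ghost values do not enter, so competitors may be cut off outside the grid. *)
Lemma eq_objective mu mu' phi phi' :
  (forall i j k, on_grid M j k -> mu i j k = mu' i j k) ->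
  (forall j k, on_grid M j k -> phi j k = phi' j k) ->
  objective mu phi = objective mu' phi'.
Proof.
move=> emu ephi; rewrite /objective /quadratic_part /dirichlet_form /mobility_form.
rewrite (eq_edge_form _ _ ephi ephi) (eq_grid_sum ephi); congr (_ - _ - _ + (_ + _ + _)).
- apply: eq_bigr => i _; apply: eq_grid_sum => j k h.
  by rewrite /boltzmann emu// ephi.
- by apply: eq_bigr => i _; apply: eq_grid_sum => j k h; rewrite emu.
- apply: eq_bigr => i _; congr (_ * _); exact: eq_edge_form (emu i) (emu i).
Qed.

(** For [m >= 0] the slope [2 * s] pays for [s * m] and leaves another [s * m]; for [m < 0] the term
    [- s * m] suffices, because [e >= 0]. *)
Lemma entropy_lower_bound (s m y e : R) : 0 <= s -> 0 <= e -> 2 * s * m - y <= e ->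
  s * `|m| - `|y| <= e - s * m.
Proof.
move=> s0 e0 ye; have [yl yr] := (ler_norm y, normr_ge0 y).
by have [/ger0_norm ->|/ltr0_norm ->] := leP 0 m; lra.
Qed.

Lemma objective_coercive : exists2 B, 0 <= B &
  forall mu phi, objective mu phi <= objective (fun _ _ _ => 0) (fun _ _ => 0) ->
  forall j k, on_grid M j k -> `|phi j k| <= B /\ forall i, `|mu i j k| <= B.
Proof.
pose T := (('I_N -> gridfun R) * gridfun R)%type.
pose q (p : T) := quadratic_part p.1 p.2.
have mob0 i (u : gridfun R) : 0 <= kappa i / 2 * mob i u u.
  by apply: mulr_ge0; [rewrite divr_ge0// ltW | apply: mobility_form_ge0; exact: cn_gt0].
have dir0 (u : gridfun R) : 0 <= beta / 2 * dir u u.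
  by apply: mulr_ge0; [rewrite divr_ge0// ltW | exact: dirichlet_form_ge0].
have smob0 (p : T) : 0 <= \sum_i kappa i / 2 * mob i (p.1 i) (p.1 i).
  by apply: sumr_ge0 => i _; exact: mob0.
have sq0 (p : T) : 0 <= S p.2 ^+ 2 / 2 by rewrite divr_ge0// sqr_ge0.
have q0 p : 0 <= q p by rewrite addr_ge0// addr_ge0.
have qmob i p : kappa i / 2 * mob i (p.1 i) (p.1 i) <= q p.
  have : kappa i / 2 * mob i (p.1 i) (p.1 i) <= \sum_i kappa i / 2 * mob i (p.1 i) (p.1 i).
    by rewrite (bigD1 i)//= lerDl; apply: sumr_ge0 => i' _; exact: mob0.
  by have := (sq0 p, dir0 p.2) => -[]; rewrite /q /quadratic_part; lra.
have qdir p : beta / 2 * dir p.2 p.2 <= q p.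
  by have := (smob0 p, sq0 p) => -[]; rewrite /q /quadratic_part; lra.
have qS p : 2^-1 * S p.2 ^+ 2 <= q p.
  by have := (smob0 p, dir0 p.2) => -[]; rewrite /q /quadratic_part; lra.
have on11 : on_grid M 1 1 by rewrite /on_grid hM.
have nS : subordinate q (fun p => S p.2).
  by apply: (subordinate_sqr (c := 2^-1)).
have nphi1 j k : on_grid M j k -> subordinate q (fun p => p.2 j k - p.2 1%N 1%N).
  apply: (subordinate_increment q0 (c := beta / 2) _ _ qdir); first by rewrite divr_gt0.
  by move=> *; split=> _; exact: ltr01.
have M2 : (M%:R : R) ^+ 2 != 0 by rewrite expf_eq0/= pnatr_eq0 -lt0n.
(* [M ^ 2] times the value at (1,1) is [S phi] minus the sum of the increments from (1,1). *)
have nphi11 : subordinate q (fun p => p.2 1%N 1%N).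
  have := subordinateZ (M%:R ^+ 2)^-1 (subordinateB nS (subordinate_grid_sum q0 nphi1)).
  by apply: eq_subordinate => p; rewrite grid_sumB grid_sum_cst subKr mulKf.
have nphi j k : on_grid M j k -> subordinate q (fun p => p.2 j k).
  by move=> /nphi1 /(subordinateD nphi11); apply: eq_subordinate => p; rewrite addrC subrK.
have nmu i j k : on_grid M j k -> subordinate q (fun p => p.1 i j k - p.1 i 1%N 1%N).
  apply: (subordinate_increment q0 (U := fun p => p.1 i) (c := kappa i / 2) _ _ (qmob i)).
    by rewrite divr_gt0.
  exact/avg_weights/cn_gt0.
pose s i := S (cn i).
have s0 i : 0 < s i.
  apply: lt_le_trans (cn_gt0 i on11) _; apply: ge_grid_sum_term => // j k h.
  exact/ltW/cn_gt0.
(* [Y1] is what remains of the pairing of [cn i] with [mu i] after splitting off [s i] times the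
   value at (1,1). [Y2] is the offset of the tangent of slope [2 * s i] to the exponential at (1,1).
   [Z] collects the errors of the lower bound; [W] bounds [phi] and the increments of [mu]. *)
pose Y1 i (p : T) := S (fun j k => cn i j k * (p.1 i j k - p.1 i 1%N 1%N)).
pose Y2 i (p : T) := 2 * s i * (z i * (p.2 1%N 1%N + phie 1%N 1%N) + (ln (2 * s i) - 1)).
pose Z (p : T) := \sum_i (`|Y1 i p| + `|Y2 i p|) + `|rho0 * S p.2|.
pose W (p : T) := S (fun j k => `|p.2 j k|)
  + \sum_i S (fun j k => `|p.1 i j k - p.1 i 1%N 1%N|).
have nZ : subordinate q Z.
  apply: subordinateD => //; last exact/subordinate_norm/subordinateZ.
  apply: (subordinate_sum q0 (F := fun p i => `|Y1 i p| + `|Y2 i p|)) => i _.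
  apply: subordinateD => //; apply: subordinate_norm.
    by apply: subordinate_grid_sum => // j k h; apply: subordinateZ => //; exact: nmu.
  apply: subordinateZ => //; apply: subordinateD => //; last exact: subordinate_cst.
  by apply: subordinateZ => //; apply: subordinateD => //; exact: subordinate_cst.
have nW : subordinate q W.
  apply: subordinateD => //.
    by apply: subordinate_grid_sum => // j k h; exact/subordinate_norm/nphi.
  apply: (subordinate_sum q0 (F := fun p i => S (fun j k => `|p.1 i j k - p.1 i 1%N 1%N|))) => i _.
  by apply: subordinate_grid_sum => // j k h; exact/subordinate_norm/nmu.
have lower p : \sum_i s i * `|p.1 i 1%N 1%N| + q p <= objective p.1 p.2 + Z p.
  have main i : s i * `|p.1 i 1%N 1%N| - (`|Y1 i p| + `|Y2 i p|)
      <= S (boltzmann p.1 p.2 i) - S (fun j k => cn i j k * p.1 i j k).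
    have -> : S (fun j k => cn i j k * p.1 i j k) = s i * p.1 i 1%N 1%N + Y1 i p.
      rewrite /s /Y1 [s i * _]mulrC -grid_sumZ -grid_sumD.
      by apply: eq_grid_sum => j k _; ring.
    (* Of all exponentials only the one at (1,1) is kept. *)
    have b11 : boltzmann p.1 p.2 i 1%N 1%N <= S (boltzmann p.1 p.2 i).
      by apply: ge_grid_sum_term => // j k _; exact: expR_ge0.
    have b0 : 0 <= boltzmann p.1 p.2 i 1%N 1%N := expR_ge0 _.
    have tangent : 2 * s i * p.1 i 1%N 1%N - Y2 i p <= boltzmann p.1 p.2 i 1%N 1%N.
      have s20 : 0 < 2 * s i by rewrite mulr_gt0.
      apply: le_trans (expR_tangent _ s20); rewrite /Y2; lra.
    have := entropy_lower_bound (ltW (s0 i)) b0 tangent.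
    by have := ler_norm (Y1 i p); lra.
  have := ler_sum (index_enum 'I_N) (P := xpredT) (fun i _ => main i).
  rewrite !sumrB /objective /Z -/(q p); have := ler_norm (rho0 * S p.2); lra.
(* The choice 1/2 leaves half of [q] after absorbing [Z]: on the sublevel set, the weighted sum of
   the [|mu i 1 1|] plus [q / 2] is at most [K] below. *)
have [C1 hC1] := nZ _ (ltac:(by rewrite invr_gt0) : 0 < 2^-1).
have [C2 hC2] := nW _ ltr01.
pose K := `|objective (fun _ _ _ => 0) (fun _ _ => 0)| + `|C1|.
have K0 : 0 <= K by rewrite addr_ge0.
have Ks0 i : 0 <= K / s i by rewrite divr_ge0// ltW.
(* A sum in place of a maximum, to have one bound for all species. *)
pose K' := \sum_i K / s i.
have K'0 : 0 <= K' by apply: sumr_ge0.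
exists (K' + (2 * K + `|C2|)); first by rewrite !addr_ge0// mulr_ge0.
move=> mu phi le0 j k h; pose p : T := (mu, phi).
have low := lower p; have sm0 : 0 <= \sum_i s i * `|p.1 i 1%N 1%N|.
  by apply: sumr_ge0 => i _; rewrite mulr_ge0// ltW.
have Zp := le_trans (ler_norm _) (hC1 p); have Wp := le_trans (ler_norm _) (hC2 p).
have g0 := ler_norm (objective (fun _ _ _ => 0) (fun _ _ => 0)).
have c1 := ler_norm C1; have c2 := ler_norm C2; have qp := q0 p.
have qK : q p <= 2 * K by rewrite /K /=; rewrite /= in low; lra.
have smK : \sum_i s i * `|p.1 i 1%N 1%N| <= K by rewrite /K /=; rewrite /= in low sm0 *; lra.
have WK : W p <= 2 * K + `|C2| by lra.
have Wphi : `|phi j k| <= S (fun j k => `|phi j k|).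
  exact: (@ge_grid_sum_term _ _ (fun j k => `|phi j k|)).
have Wmu i : `|mu i j k - mu i 1%N 1%N| <= S (fun j k => `|mu i j k - mu i 1%N 1%N|).
  exact: (@ge_grid_sum_term _ _ (fun j k => `|mu i j k - mu i 1%N 1%N|)).
have Sphi0 : 0 <= S (fun j k => `|phi j k|) by apply: grid_sum_ge0.
have Smu0 i : 0 <= S (fun j k => `|mu i j k - mu i 1%N 1%N|) by apply: grid_sum_ge0.
split=> [|i].
  have : 0 <= \sum_i S (fun j k => `|p.1 i j k - p.1 i 1%N 1%N|) by apply: sumr_ge0.
  by rewrite /W /= in WK *; lra.
have mW : S (fun j k => `|mu i j k - mu i 1%N 1%N|) <= W p.
  rewrite /W /= (bigD1 i)//= addrCA lerDl addr_ge0// sumr_ge0//.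
have m1 : `|mu i 1%N 1%N| <= K'.
  apply: (@le_trans _ _ (K / s i)); last first.
    by rewrite /K' (bigD1 i)//= lerDl sumr_ge0.
  rewrite ler_pdivlMr// mulrC; apply: le_trans smK.
  by rewrite (bigD1 i)//= lerDl sumr_ge0// => *; rewrite mulr_ge0// ltW.
have := ler_normD (mu i j k - mu i 1%N 1%N) (mu i 1%N 1%N); rewrite subrK.
by have := Wmu i; lra.
Qed.

(** The minimizer on the box of [objective_coercive] is global: competitors no worse than zero lie
    in the box after cutting off, and all others lose to zero, which is in the box. *)
Lemma objective_has_min : exists mu phi,
  forall nu psi, objective mu phi <= objective nu psi.
Proof.
have [B B0 hB] := objective_coercive.
(* [None] indexes the values of [phi], [Some i] those of [mu i]. *)
pose I := (option 'I_N * nat * nat)%type.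
pose mu_of (x : I -> R) : 'I_N -> gridfun R := fun i j k => x (Some i, j, k).
pose phi_of (x : I -> R) : gridfun R := fun j k => x (None, j, k).
have cF : continuous (fun x : prod_topology (fun _ : I => R) =>
    objective (mu_of x) (phi_of x)).
  by apply: continuous_objective => *; exact: proj_continuous.
have [x xB xmin] := box_min B0 cF.
exists (mu_of x), (phi_of x) => nu psi.
have [le0|/ltW lt0] := leP (objective nu psi) (objective (fun _ _ _ => 0) (fun _ _ => 0)).
  have {}hB := hB _ _ le0.
  (* Coercivity bounds values on the grid only, hence the cut-off. *)
  pose y : I -> R := fun '(s, j, k) =>
    if on_grid M j k then if s is Some i then nu i j k else psi j k else 0.
  have <- : objective (mu_of y) (phi_of y) = objective nu psi.
    by apply: eq_objective => [i j k h|j k h]; rewrite /mu_of /phi_of /y h.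
  apply: (xmin y) => -[[i j] k]; rewrite /y; case: ifP => [/hB[hphi hmu]|]; last by rewrite normr0.
  by case: i.
apply: le_trans lt0; apply: (xmin (fun=> 0)) => i; by rewrite normr0.
Qed.

(** Clamping the indices copies the nearest grid value to each ghost point, as the Neumann condition
    demands. *)
Definition neumann_extension (u : gridfun R) : gridfun R :=
  fun j k => u (maxn 1 (minn j M)) (maxn 1 (minn k M)).

Lemma neumann_extensionE (u : gridfun R) j k :
  on_grid M j k -> neumann_extension u j k = u j k.
Proof.
move=> /andP[/andP[j1 jM] /andP[k1 kM]]; rewrite /neumann_extension.
by rewrite (minn_idPl jM) (minn_idPl kM) (maxn_idPr j1) (maxn_idPr k1).
Qed.

Lemma discrete_neumann_extension (u : gridfun R) :
  discrete_neumann M (neumann_extension u).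
Proof.
have h1 : maxn 1 (minn 0 M) = maxn 1 (minn 1 M) by rewrite min0n (minn_idPl hM).
have h2 : maxn 1 (minn M.+1 M) = maxn 1 (minn M M) by rewrite minnn (minn_idPr _).
by split=> i _; rewrite /neumann_extension h1 h2.
Qed.

(** Stationarity yields the weak equations, electroneutrality the normalization, and the extension
    the ghost values. *)
Lemma scheme_exists : electroneutral M rho0 z cn ->
  exists c phi mu, scheme_solution M L eps rho0 D z phie dt cn c phi mu.
Proof.
move=> neutral; have [mu [phi /(@objective_stationary mu phi) st]] := objective_has_min.
pose c := boltzmann mu phi.
pose mu' i := neumann_extension (mu i); pose phi' := neumann_extension phi.
have mu'E i j k : on_grid M j k -> mu' i j k = mu i j k by exact: neumann_extensionE.
have phi'E j k : on_grid M j k -> phi' j k = phi j k by exact: neumann_extensionE.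
have weak_np i (v : gridfun R) :
    S (fun j k => c i j k * v j k) - S (fun j k => cn i j k * v j k)
    + kappa i * mob i (mu i) v = 0.
  (* Varying a single species, with [phi] fixed, isolates its transport equation. *)
  pose nu i' : gridfun R := fun j k => (i' == i)%:R * v j k.
  rewrite -(st nu (fun _ _ => 0)) /objective_derivative /dirichlet_form edge_form_cst.
  rewrite grid_sum0 !mulr0 subr0 !addr0 -[in RHS]sumrB -[in RHS]big_split [RHS](bigD1 i)//= big1 ?addr0 => [|i' /negbTE ne].
    have -> : nu i = v by apply/funext => j; apply/funext => k; rewrite /nu eqxx mul1r.
    by congr (_ - _ + _); apply: eq_grid_sum => j k _; rewrite mulr0 subr0.
  rewrite /nu ne /mobility_form edge_formZr mul0r mulr0 addr0 -grid_sumB.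
  by rewrite -[RHS](@grid_sum0 R M); apply: eq_grid_sum => j k _ /=; ring.
(* Varying [phi] alone gives the Poisson equation with the extra term [S phi * S v]. *)
have weak_poisson (v : gridfun R) :
    beta * dir phi v + S phi * S v = rho0 * S v + \sum_i z i * S (fun j k => c i j k * v j k).
  have := st (fun _ _ _ => 0) v; rewrite /objective_derivative.
  rewrite [\sum_i kappa i * _]big1 => [|i _]; last by rewrite /mobility_form edge_form_cst mulr0.
  rewrite [\sum_i S (fun j k => cn i j k * _)]big1 => [|i _]; last first.
    by rewrite -[RHS](@grid_sum0 R M); apply: eq_grid_sum => j k _; rewrite mulr0.
  have -> : \sum_i S (fun j k => boltzmann mu phi i j k * (0 - z i * v j k))
      = - \sum_i z i * S (fun j k => c i j k * v j k).
    rewrite -sumrN; apply: eq_bigr => i _; rewrite -grid_sumZ -mulN1r -grid_sumZ.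
    by apply: eq_grid_sum => j k _; rewrite /c; ring.
  lra.
(* By electroneutrality, all terms of the objective but the last, (S phi)^2 / 2,
   are invariant under phi -> phi + t, mu_i -> mu_i + t z_i. *)
have Sphi0 : S phi = 0.
  have := weak_poisson (fun _ _ => 1); rewrite /dirichlet_form edge_form_cst mulr0 add0r.
  (* Testing with 1 shows that [c] and [cn] have equal masses, hence equal total charge, which is
     zero. *)
  have cE i : S (fun j k => c i j k * 1) = S (cn i).
    have := weak_np i (fun _ _ => 1); rewrite /mobility_form edge_form_cst mulr0 addr0.
    move=> /eqP; rewrite subr_eq0 => /eqP ->.
    by apply: eq_grid_sum => j k _; rewrite mulr1.
  under eq_bigr do rewrite cE.
  have <- : S (Defs.charge rho0 z cn) = rho0 * S (fun _ _ => 1) + \sum_i z i * S (cn i).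
    rewrite -grid_sumZ; under eq_bigr do rewrite -grid_sumZ.
    by rewrite -grid_sum_sum -grid_sumD; apply: eq_grid_sum => j k _; rewrite mulr1.
  rewrite neutral grid_sum_cst mulr1 => /eqP; rewrite mulf_eq0 => /orP[/eqP//|].
  by rewrite expf_eq0/= pnatr_eq0 eqn0Ngt hM.
(* Point masses as test functions turn the weak identities into equations at each grid point. *)
pose delta p r : gridfun R := fun j k => ((j == p) && (k == r))%:R.
have sum_delta (u : gridfun R) p r : on_grid M p r -> S (fun j k => u j k * delta p r j k) = u p r.
  move=> h; rewrite -[RHS](grid_sum_delta u h); apply: eq_grid_sum => j k _.
  by rewrite mulrC.
(* Since the form ignores ghost values, [u] may be replaced by its Neumann extension, to which
   summation by parts applies. *)
have form_delta a b (u : gridfun R) p r : on_grid M p r ->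
    edge_form M a b u (delta p r) = - wlap a b (neumann_extension u) p r.
  move=> h; rewrite -(sum_delta _ _ _ h).
  under [in RHS]eq_grid_sum => j k _ do rewrite mulrC.
  rewrite grid_sum_wlap//; last exact: discrete_neumann_extension.
  by rewrite opprK; apply: eq_edge_form => // j k g; rewrite neumann_extensionE.
have np i j k : on_grid M j k ->
    c i j k - cn i j k = kappa i * wlap (avgx (cn i)) (avgy (cn i)) (mu' i) j k.
  move=> h; have := weak_np i (delta j k).
  by rewrite /mobility_form form_delta// !sum_delta//; lra.
have poisson j k : on_grid M j k ->
    - beta * wlap (unit_weight R) (unit_weight R) phi' j k = Defs.charge rho0 z c j k.
  move=> h; have := weak_poisson (delta j k).
  rewrite Sphi0 mul0r addr0 /dirichlet_form form_delta// mulrN mulNr => ->.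
  rewrite /Defs.charge; congr (_ + _); last by apply: eq_bigr => i _; rewrite sum_delta.
  rewrite -[LHS]/(rho0 * S (delta j k)) -[RHS]mulr1 -(sum_delta (fun _ _ => 1) _ _ h).
  by congr (_ * _); apply: eq_grid_sum => *; rewrite mul1r.
exists c, phi', mu'; split=> [i j k h|i j k h|i|i j k h|].
- by exists (mu i j k - z i * (phi j k + phie j k)).
- by rewrite /c /boltzmann expRK mu'E// phi'E//; ring.
- exact: discrete_neumann_extension.
- rewrite (@scheme_npE _ _ M cn i _ j k h) np// /kappa; field.
  by rewrite !gt_eqF// ?dx_gt0.
- split; last by rewrite (eq_grid_sum phi'E).
  + move=> j k h; rewrite -poisson// /beta /wlap /unit_weight; field.
    by rewrite gt_eqF// dx_gt0.
  + exact: discrete_neumann_extension.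
Qed.

End Existence.

Theorem theorem3p4 (R : realType) (N M : nat) (hN : (1 <= N)%N) (hM : (1 <= M)%N)
    (L eps rho0 : R) (D z : 'I_N -> R) (phie : gridfun R)
    (hL : 0 < L) (heps : 0 < eps) (hD : forall i, 0 < D i)
    (dt : R) (hdt : 0 < dt)
    (cn : 'I_N -> gridfun R) (phin : gridfun R)
    (hneutral : electroneutral M rho0 z cn)
    (hphin : potential_of M L eps rho0 z cn phin) :
  (forall c phi mu, scheme_solution M L eps rho0 D z phie dt cn c phi mu ->
     forall i, dx M L ^+ 2 * grid_sum M (c i) = dx M L ^+ 2 * grid_sum M (cn i)) /\
  ((forall i j k, on_grid M j k -> 0 < cn i j k) ->
   [/\ (exists c phi mu, scheme_solution M L eps rho0 D z phie dt cn c phi mu) /\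
       (forall c1 phi1 mu1 c2 phi2 mu2,
          scheme_solution M L eps rho0 D z phie dt cn c1 phi1 mu1 ->
          scheme_solution M L eps rho0 D z phie dt cn c2 phi2 mu2 ->
          forall j k, on_grid M j k ->
            (forall i, c1 i j k = c2 i j k) /\ phi1 j k = phi2 j k),
       (forall c phi mu, scheme_solution M L eps rho0 D z phie dt cn c phi mu ->
          forall i j k, on_grid M j k -> 0 < c i j k)
     & (forall c phi mu, scheme_solution M L eps rho0 D z phie dt cn c phi mu ->
          energy M rho0 z phie c phi - energy M rho0 z phie cn phin
          <= - dt * dissipation M L D cn mu)]).
Proof.
split=> [c phi mu s i|cn_gt0]; first by rewrite (scheme_mass hM hdt s).
split; first split.
- exact: scheme_exists.
- move=> c1 phi1 mu1 c2 phi2 mu2; exact: scheme_unique.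
- by move=> c phi mu s i j k h; exact: scheme_gt0 s i j k h.
- by move=> c phi mu s; exact: scheme_energy s.
Qed.
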